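(* Let $G$ be a graph on $n$ vertices with at least one edge. Let \[ C=\max\left\{ \deg(x) + \left\lfloor\frac{\deg(y)}{2}\right\rfloor + 1 \right\}, \] where the maximum is over all ordered pairs of vertices $x,y$ such that $(x,y)$ is an edge of $G$. If $G$ is claw-free, then \[ \operatorname{pd}(S/I(G))\leq n\left(1-\frac{1}{C}\right). \]
   Context: All graphs are finite and simple. A claw is a graph isomorphic to the complete bipartite graph $K_{1,3}$; a graph is claw-free if it has no induced subgraph that is a claw. Let $S$ be the polynomial ring over a fixed field whose variables are the vertices of $G$, and let $I(G) = (xy : (x,y) \text{ is an edge of } G)\subset S$ be the edge ideal of $G$. $\operatorname{pd}$ denotes projective dimension over $S$. *)

(* Defs.v *)
(* Conventions: a finite simple graph is a symmetric irreflexive [e : rel T] on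
   a finType T; [boolp] is used only to make ideal membership boolean. *)
From HB Require Import structures.
From mathcomp Require Import all_boot all_order all_algebra.
From mathcomp Require Import generic_quotient ring_quotient.
From mathcomp Require Import boolp.
From mathcomp Require Import mpoly.

Set Implicit Arguments.
Unset Strict Implicit.
Unset Printing Implicit Defensive.

Import Order.TTheory GRing.Theory Num.Theory.
Local Open Scope ring_scope.
Local Open Scope quotient_scope.

Section QuotientModule.
Variables (R : pzRingType) (V : lmodType R) (N : submodClosed V).

(* [submodClosed] is declared over semimodules and so does not inherit from
   [zmodClosed], which the quotient construction of [ring_quotient] expects. *)
Fact submod_zmod_closed : zmod_closed N.
Proof. exact: GRing.submod_closedB (submodClosedP N). Qed.

Definition submod_zmod : zmodClosed V :=
  HB.pack (GRing.SubmodClosed.sort N)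
    (GRing.isZmodClosed.Build V (GRing.SubmodClosed.sort N) submod_zmod_closed).

(* [ring_quotient] only provides the quotient as a Z-module. *)
Definition quotmod := Quotient.quot submod_zmod.

HB.instance Definition _ := GRing.Zmodule.on quotmod.
HB.instance Definition _ : EqQuotient V (Quotient.equiv submod_zmod) quotmod :=
  EqQuotient.on quotmod.

Definition quotmod_scale (a : R) (u : quotmod) : quotmod :=
  \pi_quotmod (a *: repr u).

Lemma quotmod_pi_eq (x y : V) :
  (\pi_quotmod x == \pi_quotmod y) = (x - y \in N).
Proof. by rewrite [LHS]piE. Qed.

Lemma quotmod_piD (x y : V) :
  \pi_quotmod (x + y) = \pi_quotmod x + \pi_quotmod y.
Proof. exact: (@Quotient.pi_add V submod_zmod). Qed.

Lemma quotmod_piZ (a : R) (x : V) :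
  \pi_quotmod (a *: x) = quotmod_scale a (\pi_quotmod x).
Proof.
apply/eqP; rewrite quotmod_pi_eq -scalerBr rpredZ //.
by rewrite -quotmod_pi_eq reprK.
Qed.

Lemma quotmod_scalerA (a b : R) (u : quotmod) :
  quotmod_scale a (quotmod_scale b u) = quotmod_scale (a * b) u.
Proof. by rewrite -[u]reprK -!(quotmod_piZ _ (repr u)) -quotmod_piZ scalerA. Qed.

Lemma quotmod_scale1r : left_id 1 quotmod_scale.
Proof. by move=> u; rewrite -[u]reprK -quotmod_piZ scale1r. Qed.

Lemma quotmod_scalerDr : right_distributive quotmod_scale +%R.
Proof.
move=> a u v; rewrite -[u]reprK -[v]reprK -quotmod_piD -!quotmod_piZ scalerDr.
by rewrite quotmod_piD.
Qed.

Lemma quotmod_scalerDl (u : quotmod) :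
  {morph quotmod_scale^~ u : a b / a + b}.
Proof.
by move=> a b; rewrite -[u]reprK -!quotmod_piZ scalerDl quotmod_piD.
Qed.

HB.instance Definition _ := GRing.Zmodule_isLmodule.Build R quotmod
  quotmod_scalerA quotmod_scale1r quotmod_scalerDr quotmod_scalerDl.

End QuotientModule.

Section GeneratedIdeal.
Variables (R : comNzRingType) (A : R -> Prop).

Definition gen_ideal_prop (p : R) : Prop :=
  exists2 s : seq (R * R), (forall cg, cg \in s -> A cg.2)
                         & p = \sum_(cg <- s) cg.1 * cg.2.

(* An ideal is a submodule of the regular module R^o; its predicate carries
   the [submodClosed] structure needed to form the quotient. *)
Definition gen_ideal (p : R^o) : bool := `[< gen_ideal_prop p >].

Lemma gen_ideal_submod_closed : submod_closed gen_ideal.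
Proof.
split=> [|a p q /asboolP[s sA ->] /asboolP[t tA ->]]; apply/asboolP.
  by exists [::] => //; rewrite big_nil.
exists ([seq (a * cg.1, cg.2) | cg <- s] ++ t).
  move=> cg; rewrite mem_cat => /orP[/mapP[dg /sA dgA ->] //|/tA //].
rewrite big_cat big_map /= scaler_sumr; congr (_ + _).
by apply: eq_bigr => cg _; rewrite /GRing.scale /= mulrA.
Qed.

HB.instance Definition _ :=
  GRing.isSubmodClosed.Build R R^o gen_ideal gen_ideal_submod_closed.

End GeneratedIdeal.

Section ProjectiveDimension.
Variable R : pzRingType.

Definition projective (P : lmodType R) : Prop :=
  forall (M N : lmodType R) (f : {linear M -> N}) (g : {linear P -> N}),
    (forall y, exists x, f x = y) ->
    exists h : {linear P -> M}, forall x, f (h x) = g x.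

(* ... -> P 2 -> P 1 -> P 0 -> M -> 0 *)
Record proj_resolution (M : lmodType R) := ProjResolution {
  res_mod :> nat -> lmodType R;
  res_diff : forall i, {linear res_mod i.+1 -> res_mod i};
  res_aug : {linear res_mod 0 -> M};
  res_projective : forall i, projective (res_mod i);
  res_aug_surj : forall y, exists x, res_aug x = y;
  res_exact0 : forall x, res_aug x = 0 <-> exists y, res_diff 0 y = x;
  res_exactS : forall i x,
    res_diff i x = 0 <-> exists y, res_diff i.+1 y = x
}.

Definition res_length_le (M : lmodType R) (P : proj_resolution M) (d : nat) :=
  forall i, (d < i)%N -> forall x : P i, x = 0.

Definition pd_le (M : lmodType R) (d : nat) : Prop :=
  exists P : proj_resolution M, res_length_le P d.

(* In particular, M has finite projective dimension. *)
Definition has_pd (M : lmodType R) (d : nat) : Prop :=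
  pd_le M d /\ forall d', pd_le M d' -> (d <= d')%N.

End ProjectiveDimension.

Section Graphs.
Variables (T : finType) (e : rel T).

Definition deg (x : T) : nat := #|[set y | e x y]|.

Definition Kbip (m n : nat) : rel ('I_m + 'I_n) := fun u v =>
  match u, v with
  | inl _, inr _ | inr _, inl _ => true
  | _, _ => false
  end.

Definition has_induced (U : finType) (h : rel U) : Prop :=
  exists2 f : U -> T, injective f & forall u v, e (f u) (f v) = h u v.

Definition claw_free : Prop := ~ has_induced (@Kbip 1 3).

Definition degC : nat :=
  \max_(p : T * T | e p.1 p.2) (deg p.1 + (deg p.2)./2 + 1)%N.

Variable k : fieldType.

(* The variable of a vertex x is indexed by its rank in the enumeration of T. *)
Definition vertex_var (x : T) : {mpoly k[#|T|]} := 'X_(enum_rank x).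

Definition edge_gens (p : {mpoly k[#|T|]}) : Prop :=
  exists x y, e x y /\ p = vertex_var x * vertex_var y.

Definition edge_ideal : submodClosed {mpoly k[#|T|]}^o :=
  GRing.SubmodClosed.clone _ _ (gen_ideal edge_gens) _.

Definition edge_quotient : lmodType {mpoly k[#|T|]} := quotmod edge_ideal.

End Graphs.

(* Main.v *)
(* Dao-Schweig's argument. For a vertex x the sequence
   0 -> S/(I : x) -> S/I -> S/(I, x) -> 0 bounds pd (S/I) by the maximum of the
   outer terms, and for an edge ideal both are again given by some variables plus
   the edge ideal of an induced subgraph: either x alone becomes a variable, or
   its neighbours do and x is deleted. Fix a vertex v and treat its neighbours
   one by one. Each branch ends with r variables acquired and r + 1 vertices
   deleted: in the colon branches the treated vertex x is free, and in the last
   branch v has become isolated. As r variables for r + 1 vertices is within the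
   rate 1 - 1/C as soon as r + 1 <= C, it remains to order the neighbours so that
   each x has at most deg(v)/2 earlier non-neighbours. By claw-freeness
   non-adjacency in N(v) is triangle-free, hence every subset R of N(v) has a
   vertex with at most |R|/2 non-neighbours in R; put it last and iterate. *)
Require Import Defs.
From HB Require Import structures.
From mathcomp Require Import generic_quotient ring_quotient boolp mpoly.
(* After mpoly, which shadows [symmetric]. *)
From mathcomp Require Import all_boot all_order all_algebra.
From mathcomp Require Import zify.

Set Implicit Arguments.
Unset Strict Implicit.
Unset Printing Implicit Defensive.

Import Order.TTheory GRing.Theory Num.Theory.
Local Open Scope ring_scope.
Local Open Scope quotient_scope.

(** * Kernels of linear maps as modules *)

Section LinearKernel.
Variables (R : pzRingType) (M N : lmodType R) (f : {linear M -> N}).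

Definition ker_pred : pred M := fun x => f x == 0.

Fact ker_submod_closed : submod_closed ker_pred.
Proof.
split=> [|a x y]; rewrite !unfold_in ?linear0 ?linearP //.
by move=> /eqP-> /eqP->; rewrite scaler0 addr0.
Qed.

HB.instance Definition _ := GRing.isSubmodClosed.Build R M ker_pred ker_submod_closed.

Record kermod := Kermod { kermod_val :> M; _ : kermod_val \in ker_pred }.

HB.instance Definition _ := [isSub for kermod_val].
HB.instance Definition _ := [Choice of kermod by <:].
HB.instance Definition _ := [SubChoice_isSubLmodule of kermod by <:].

End LinearKernel.

(** * Short exact sequences and resolutions of bounded length *)

Section HomologicalAlgebra.
Variable R : pzRingType.
Implicit Types A B C M N P Q K L : lmodType R.

Definition linear_of M N (f : M -> N) (lin_f : linear f) : {linear M -> N} :=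
  HB.pack f (GRing.isLinear.Build R M N *:%R f lin_f).

Definition surj M N (f : M -> N) : Prop := forall y, exists x, f x = y.

Definition short_exact M N L (f : {linear M -> N}) (g : {linear N -> L}) : Prop :=
  [/\ injective f, surj g & forall y, g y = 0 <-> exists x, f x = y].

Definition ker_incl M N (f : {linear M -> N}) : {linear kermod f -> M} := val.

Lemma short_exact_ker M N (f : {linear M -> N}) :
  surj f -> short_exact (ker_incl f) f.
Proof.
move=> f_surj; split=> // [|y]; first exact: val_inj.
split=> [fy0|[[x /= x_ker] <-]]; last by apply/eqP.
have y_ker : y \in ker_pred f by rewrite unfold_in fy0.
by exists (Kermod y_ker).
Qed.

Lemma linear_inj M N (f : {linear M -> N}) :
  (forall x, f x = 0 -> x = 0) -> injective f.
Proof.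
move=> f0 x y fxy; apply/eqP; rewrite -subr_eq0; apply/eqP/f0.
by rewrite linearB /= fxy subrr.
Qed.

Lemma projective_zero M : (forall x : M, x = 0) -> projective M.
Proof.
move=> M0 A B f g _; exists (\0 : {linear M -> A}) => x.
by rewrite (M0 x) !linear0.
Qed.

Lemma projective_prod P Q : projective P -> projective Q -> projective (P * Q)%type.
Proof.
move=> projP projQ A B f g f_surj.
have lin1 : linear (fun x : P => g (x, 0)).
  by move=> a x y; rewrite -linearP; congr (g (_, _)); rewrite /= scaler0 addr0.
have lin2 : linear (fun y : Q => g (0, y)).
  by move=> a x y; rewrite -linearP; congr (g (_, _)); rewrite /= scaler0 addr0.
have [h1 fh1] := projP _ _ f (linear_of lin1) f_surj.
have [h2 fh2] := projQ _ _ f (linear_of lin2) f_surj.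
have linh : linear (fun z : P * Q => h1 z.1 + h2 z.2).
  by move=> a x y /=; rewrite !linearP scalerDr addrACA.
exists (linear_of linh) => -[x y] /=.
by rewrite linearD fh1 fh2 /= -linearD /=; congr (g (_, _)); rewrite ?addr0 ?add0r.
Qed.

Lemma projective_regular : projective (R^o : lmodType R).
Proof.
move=> A B f g f_surj; have [a fa] := f_surj (g 1).
have lin : linear (fun r : R^o => (r : R) *: a).
  by move=> r x y; rewrite scalerDl scalerA.
exists (linear_of lin) => r /=.
by rewrite linearZ /= fa -linearZ /= /GRing.scale /= mulr1.
Qed.

(** The preimages picked by choice are unique because [i] is injective, and this makes the choice
    linear. *)
Lemma linear_lift M N K (i : {linear K -> N}) (h : {linear M -> N}) :
  injective i -> (forall x, exists y, i y = h x) ->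
  exists l : {linear M -> K}, forall x, i (l x) = h x.
Proof.
move=> i_inj /choice[l il].
have lin_l : linear l by move=> a x y; apply: i_inj; rewrite linearP !il linearP.
by exists (linear_of lin_l).
Qed.

(* [res_le d M]: M has a projective resolution whose modules of index at least
   d vanish, i.e. pd M < d; the shift makes the base case M = 0. *)
Fixpoint res_le (d : nat) M : Prop :=
  if d is d'.+1 then
    exists P K (i : {linear K -> P}) (p : {linear P -> M}),
      [/\ projective P, short_exact i p & res_le d' K]
  else forall x : M, x = 0.

Lemma res_leS d M : res_le d M -> res_le d.+1 M.
Proof.
elim: d M => [|d IHd] M.
  move=> M0; exists M, M, (\0 : {linear M -> M}), (idfun : {linear M -> M}).
  split=> //; first exact: projective_zero.
  split=> [x y _|y|y]; first by rewrite (M0 x) (M0 y).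
    by exists y.
  by split=> _; [exists y; rewrite (M0 y) linear0 | rewrite (M0 y) linear0].
by move=> [P [K [i [p [projP ex /IHd resK]]]]]; exists P, K, i, p.
Qed.

Lemma res_le_leq d d' M : (d <= d')%N -> res_le d M -> res_le d' M.
Proof.
move=> /subnKC <-; elim: (d' - d)%N => [|m IHm]; rewrite ?addn0 ?addnS //.
by move=> /IHm/res_leS.
Qed.

Lemma res_le_cover d M P (p : {linear P -> M}) :
  projective P -> surj p -> res_le d (kermod p) -> res_le d.+1 M.
Proof.
by move=> projP /short_exact_ker ex resK; exists P, (kermod p), (ker_incl p), p.
Qed.

(** Composing the cover with [f] keeps its kernel, so the same syzygies serve. *)
Lemma res_le_iso d M N (f : {linear M -> N}) :
  injective f -> surj f -> res_le d.+1 M -> res_le d.+1 N.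
Proof.
move=> f_inj f_surj [P [K [i [p [projP [i_inj p_surj ex] resK]]]]].
exists P, K, i, (f \o p : {linear P -> N}); split=> //; split=> // [y|y] /=.
  by have [x <-] := f_surj y; have [z <-] := p_surj x; exists z.
by rewrite -ex; split=> [|->]; rewrite ?linear0 // -(linear0 f) => /f_inj.
Qed.

(* The horseshoe lemma: P x Q covers B, and its kernel is an extension of L by K. *)
Lemma res_le_ext d A B C (f : {linear A -> B}) (g : {linear B -> C}) :
  short_exact f g -> res_le d A -> res_le d C -> res_le d B.
Proof.
elim: d A B C f g => [|d IHd] A B C f g [f_inj g_surj ex].
  by move=> A0 C0 y; have /ex[x <-] := C0 (g y); rewrite (A0 x) linear0.
move=> [P [K [i [p [projP [i_inj p_surj exP] resK]]]]].
move=> [Q [L [j [q [projQ [j_inj q_surj exQ] resL]]]]].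
have [s gs] := projQ _ _ g q g_surj.
have lin_phi : linear (fun z : P * Q => f (p z.1) + s z.2).
  by move=> a x y /=; rewrite !linearP scalerDr addrACA.
pose phi := linear_of lin_phi.
have phiE z : phi z = f (p z.1) + s z.2 by [].
have g_phi z : g (phi z) = q z.2.
  rewrite phiE linearD /= gs; have -> : g (f (p z.1)) = 0 by apply/ex; exists (p z.1).
  by rewrite add0r.
have phi_surj : surj phi.
  move=> b; have [y qy] := q_surj (g b).
  have [|a fa] := (ex (b - s y)).1; first by rewrite linearB /= gs qy subrr.
  by have [x px] := p_surj a; exists (x, y); rewrite phiE /= px fa subrK.
apply: (res_le_cover (projective_prod projP projQ) phi_surj).
have [incl_inj _ exK] := short_exact_ker phi_surj.
have lin_iota : linear (fun x : K => (i x, 0 : Q)).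
  by move=> a x y; rewrite linearP; congr (_, _); rewrite /= scaler0 addr0.
have [u uE] : exists u : {linear K -> kermod phi},
    forall x, ker_incl phi (u x) = (i x, 0).
  apply: (linear_lift (h := linear_of lin_iota) incl_inj) => x; apply/exK.
  rewrite phiE /= linear0 addr0; have -> : p (i x) = 0 by apply/exP; exists x.
  by rewrite linear0.
have lin_snd : linear (fun z : kermod phi => (ker_incl phi z).2) by [].
have [v vE] : exists v : {linear kermod phi -> L}, forall z, j (v z) = (ker_incl phi z).2.
  apply: (linear_lift (h := linear_of lin_snd) j_inj) => z; apply/exQ.
  rewrite /= -g_phi; have -> : phi (ker_incl phi z) = 0 by apply/exK; exists z.
  by rewrite linear0.
apply: (IHd _ _ _ u v) => //; split.
- by move=> x y /(congr1 (ker_incl phi)); rewrite !uE => -[/i_inj].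
- move=> y; have qjy : g (s (j y)) = 0 by rewrite gs; apply/exQ; exists y.
  (* The lift [s (j y)] dies in [C], so it equals [f (p x)] for some [x], and [(- x, j y)] lies in
     the kernel of [phi]. *)
  have [a fa] := (ex _).1 qjy; have [x px] := p_surj a.
  have [|z zE] := (exK (- x, j y)).1.
    by rewrite phiE /= linearN px linearN fa addNr.
  by exists z; apply: j_inj; rewrite vE zE.
- move=> z; split=> [vz0|[x <-]]; last by apply: j_inj; rewrite vE uE linear0.
  have z2 : (ker_incl phi z).2 = 0 by rewrite -vE vz0 linear0.
  have : phi (ker_incl phi z) = 0 by apply/exK; exists z.
  rewrite phiE z2 linear0 addr0 -(linear0 f) => /f_inj/exP[x ix].
  by exists x; apply: incl_inj; rewrite uE ix -z2; case: (ker_incl phi z).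
Qed.

(* K is the kernel of P -> B -> C, an extension of A by the kernel of P -> B. *)
Lemma res_le_coker d A B C (f : {linear A -> B}) (g : {linear B -> C}) :
  short_exact f g -> res_le d A -> res_le d.+1 B -> res_le d.+1 C.
Proof.
move=> [f_inj g_surj ex] resA [P [L [i [p [projP [i_inj p_surj exP] resL]]]]].
pose q : {linear P -> C} := (g \o p)%FUN.
have q_surj : surj q.
  by move=> c; have [b <-] := g_surj c; have [x <-] := p_surj b; exists x.
apply: (res_le_cover projP q_surj).
have [incl_inj _ exK] := short_exact_ker q_surj.
have [u uE] : exists u : {linear L -> kermod q}, forall x, ker_incl q (u x) = i x.
  apply: (linear_lift (h := i) incl_inj) => x; apply/exK; rewrite /=.
  by have -> : p (i x) = 0; [apply/exP; exists x | rewrite linear0].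
have [v vE] : exists v : {linear kermod q -> A}, forall z, f (v z) = p (ker_incl q z).
  apply: (linear_lift (h := (p \o ker_incl q : {linear kermod q -> B}))) => // z.
  by apply/ex; apply: (exK (ker_incl q z)).2; exists z.
apply: (res_le_ext (f := u) (g := v)) => //; split.
- by move=> x y /(congr1 (ker_incl q)); rewrite !uE => /i_inj.
- move=> a; have [x px] := p_surj (f a).
  have [|z zE] := (exK x).1; first by rewrite /= px; apply/ex; exists a.
  by exists z; apply: f_inj; rewrite vE zE.
- move=> z; split=> [vz0|[x <-]].
    have [|x ix] := (exP (ker_incl q z)).1; first by rewrite -vE vz0 linear0.
    by exists x; apply: incl_inj; rewrite uE.
  by apply: f_inj; rewrite vE uE linear0; apply/exP; exists x.
Qed.

(** The nested covers of [res_le] are spliced into one sequence: the augmentation onto the kernel,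
    followed by its inclusion, becomes the first differential. *)
Lemma res_le_pd_le d M : res_le d.+1 M -> pd_le M d.
Proof.
suff H e N : res_le e N ->
    exists P : proj_resolution N, forall i, (e <= i)%N -> forall x : P i, x = 0.
  by move=> /H.
elim: e N => [|e IHe] N.
  move=> N0.
  unshelve eexists (@ProjResolution R N (fun=> N) (fun=> \0 : {linear N -> N})
    (idfun : {linear N -> N}) _ _ _ _) => //=.
  - by move=> _; apply: projective_zero.
  - by move=> y; exists y.
move=> [P [K [i [p [projP [i_inj p_surj ex] /IHe[Q Q0]]]]]].
pose Pm n := if n is n'.+1 then Q n' else P.
pose Pd n : {linear Pm n.+1 -> Pm n} :=
  match n with
  | 0 => (i \o res_aug Q)%FUN : {linear Pm 1%N -> Pm 0%N}
  | n'.+1 => res_diff Q n'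
  end.
unshelve eexists (@ProjResolution R N Pm Pd p _ _ _ _) => //=.
- by case=> [|n] //=; apply: res_projective.
- move=> x; rewrite ex; split=> [[y <-]|[y <-]]; last by exists (res_aug Q y).
  by have [z <-] := res_aug_surj Q y; exists z.
- case=> [|n] x /=; last exact: res_exactS.
  by rewrite -res_exact0; split=> [|->]; rewrite ?linear0 // -(linear0 i) => /i_inj.
- by case=> [|n] //= en; apply: Q0.
Qed.

Lemma ex_has_pd d M : pd_le M d -> exists2 d', has_pd M d' & (d' <= d)%N.
Proof.
move=> pdM; have exM : exists d, `[< pd_le M d >] by exists d; apply/asboolP.
case: (ex_minnP exM) => d' /asboolP pdM' d'_min.
by exists d'; [split=> // m /asboolP/d'_min | apply/d'_min/asboolP].
Qed.

End HomologicalAlgebra.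

(** * Linear maps induced on quotients *)

Section QuotientMaps.
Variable R : pzRingType.

Lemma quotmod_map (V W : lmodType R) (I : submodClosed V) (J : submodClosed W)
    (phi : {linear V -> W}) :
  (forall x, x \in I -> phi x \in J) ->
  exists f : {linear quotmod I -> quotmod J},
    forall x, f (\pi_(quotmod I) x) = \pi_(quotmod J) (phi x).
Proof.
move=> phiIJ; pose f (u : quotmod I) : quotmod J := \pi_(quotmod J) (phi (repr u)).
have f_pi x : f (\pi_(quotmod I) x) = \pi_(quotmod J) (phi x).
  apply/eqP; rewrite /f quotmod_pi_eq -linearB phiIJ //.
  by rewrite -quotmod_pi_eq reprK.
have lin_f : linear f.
  move=> a u v; rewrite -[u]reprK -[v]reprK.
  rewrite -[a *: _]quotmod_piZ -quotmod_piD !f_pi linearP quotmod_piD.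
  by rewrite [X in X + _]quotmod_piZ.
by exists (linear_of lin_f) => x; rewrite -f_pi.
Qed.

(** [I] is the preimage of [J], which gives injectivity; [K] is the sum of [J] and the image of
    [phi], which gives exactness in the middle. *)
Lemma quotmod_short_exact (V W : lmodType R) (I : submodClosed V)
    (J K : submodClosed W) (phi : {linear V -> W}) :
  (forall x, (x \in I) = (phi x \in J)) ->
  (forall z, z \in K <-> exists y, z - phi y \in J) ->
  exists (f : {linear quotmod I -> quotmod J}) (g : {linear quotmod J -> quotmod K}),
    short_exact f g.
Proof.
move=> IphiJ KJ.
have [|f fE] := @quotmod_map V W I J phi; first by move=> x; rewrite IphiJ.
have [|g gE] := @quotmod_map W W J K (idfun : {linear W -> W}).
  by move=> x Jx; apply/KJ; exists 0; rewrite linear0 subr0.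
have pi0 (U : lmodType R) (L : submodClosed U) x : \pi_(quotmod L) x = 0 <-> x \in L.
  rewrite -[X in X \in L]subr0 -quotmod_pi_eq.
  have -> : \pi_(quotmod L) 0 = 0.
    by apply: (addrI (\pi_(quotmod L) 0)); rewrite -quotmod_piD !addr0.
  by split=> /eqP.
exists f, g; split.
- apply: linear_inj => u; rewrite -[u]reprK fE => /pi0.
  by rewrite -IphiJ => /pi0.
- by move=> u; exists (\pi_(quotmod J) (repr u)); rewrite gE reprK.
- move=> u; rewrite -[u]reprK gE; split=> [/pi0/KJ[y Jy]|[v]].
    exists (\pi_(quotmod I) y); apply/eqP.
    by rewrite fE eq_sym quotmod_pi_eq.
  rewrite -[v]reprK fE => /eqP; rewrite eq_sym quotmod_pi_eq => Jv.
  by apply/pi0/KJ; exists (repr v).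
Qed.

(** Equal ideals given by different predicates have different quotient types; this lets resolutions
    pass from one to the other. *)
Lemma quotmod_iso (V : lmodType R) (I J : submodClosed V) : I =i J ->
  exists f : {linear quotmod I -> quotmod J}, injective f /\ surj f.
Proof.
move=> IJ; have [|f fE] := @quotmod_map V V I J (idfun : {linear V -> V}).
  by move=> x; rewrite IJ.
exists f; split=> [u v|u]; last first.
  by exists (\pi_(quotmod I) (repr u)); rewrite fE reprK.
rewrite -[u]reprK -[v]reprK !fE => /eqP; rewrite quotmod_pi_eq -IJ.
by rewrite -quotmod_pi_eq => /eqP.
Qed.

End QuotientMaps.

(** * Monomial ideals, given by their sets of exponents *)

Record upset n := Upset {
  up_pred :> pred 'X_{1..n};
  upD : forall m m', up_pred m -> up_pred (m + m')%MM
}.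

Section MonomialIdeals.
Variables (n : nat) (k : fieldType).
Implicit Types (B : upset n) (p q : {mpoly k[n]}^o) (m : 'X_{1..n}).
Local Notation S := ({mpoly k[n]}^o : lmodType {mpoly k[n]}).

Definition mono_pred (B : upset n) : pred {mpoly k[n]}^o :=
  fun p => all B (msupp (p : {mpoly k[n]})).

Fact mono_submod_closed B : submod_closed (mono_pred B).
Proof.
split=> [|a p q /allP Bp /allP Bq]; first by rewrite unfold_in /mono_pred msupp0.
apply/allP => m /msuppD_le; rewrite mem_cat => /orP[|/Bq //].
by move=> /msuppM_le/allpairsP[[m1 m2] /= [_ /Bp Bm ->]]; rewrite addmC upD.
Qed.

Definition mono_ideal B : submodClosed S :=
  HB.pack (mono_pred B)
    (GRing.isSubmodClosed.Build _ S (mono_pred B) (mono_submod_closed B)).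

Lemma mono_idealP B p :
  reflect {in msupp (p : {mpoly k[n]}), forall m, B m} (p \in mono_ideal B).
Proof. exact: allP. Qed.

(** [BC] describes the colon ideal by ['X_[m0]] and [BQ] the ideal enlarged by ['X_[m0]]; the first
    map is multiplication by ['X_[m0]]. *)
Lemma mono_short_exact (B BC BQ : upset n) m0 :
  (forall m, BC m = B (m + m0)%MM) -> (forall m, BQ m = B m || (m0 <= m)%MM) ->
  exists (f : {linear quotmod (mono_ideal BC) -> quotmod (mono_ideal B)})
         (g : {linear quotmod (mono_ideal B) -> quotmod (mono_ideal BQ)}),
    short_exact f g.
Proof.
move=> BCE BQE.
have lin_phi : linear (fun p : S => (p : {mpoly k[n]}) * 'X_[m0] : S).
  by move=> a p q; rewrite mulrDl -[a *: p]/(a * p) -mulrA.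
apply: (quotmod_short_exact (phi := linear_of lin_phi)) => [p|p] /=.
  apply/mono_idealP/mono_idealP => Bp m.
    by rewrite (perm_mem (msuppMX _ _)) => /mapP[m' /Bp Bm ->]; rewrite addmC -BCE.
  by move=> pm; rewrite BCE addmC Bp // (perm_mem (msuppMX _ _)) map_f.
split=> [/mono_idealP BQp|[q /mono_idealP Bpq]].
  (* The terms of [p] outside [B] are divisible by ['X_[m0]]; the witness is their sum divided by
     it. *)
  exists (\sum_(m <- msupp (p : {mpoly k[n]}) | ~~ B m) p@_m *: 'X_[m - m0]).
  have -> : p - (\sum_(m <- msupp (p : {mpoly k[n]}) | ~~ B m) p@_m *: 'X_[m - m0]) * 'X_[m0]
      = \sum_(m <- msupp (p : {mpoly k[n]}) | B m) p@_m *: 'X_[m] :> {mpoly k[n]}.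
    rewrite [X in X - _]mpolyE (bigID (fun m => B m)) /= mulr_suml.
    rewrite [X in _ + X - _]big_seq_cond [X in _ - X]big_seq_cond -addrA -sumrB.
    rewrite [X in _ + X]big1 ?addr0 // => m /andP[/BQp]; rewrite BQE.
    move=> /orP[->//|m0m] _; apply/eqP; rewrite subr_eq0 -scalerAl -mpolyXD.
    by rewrite submK.
  apply/mono_idealP => m /msupp_sum_le/flatten_mapP[m'].
  by rewrite mem_filter => /andP[Bm' _] /msuppZ_le; rewrite msuppX inE => /eqP ->.
rewrite -[p](subrK (q * 'X_[m0])); apply/mono_idealP => m /msuppD_le.
rewrite mem_cat BQE => /orP[/Bpq -> //|].
by rewrite (perm_mem (msuppMX _ _)) => /mapP[m' _ ->]; rewrite lem_addr ?orbT.
Qed.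

Lemma mono_res_ext d (B BC BQ : upset n) m0 :
  (forall m, BC m = B (m + m0)%MM) -> (forall m, BQ m = B m || (m0 <= m)%MM) ->
  res_le d (quotmod (mono_ideal BC)) -> res_le d (quotmod (mono_ideal BQ)) ->
  res_le d (quotmod (mono_ideal B)).
Proof.
move=> BCE BQE; have [f [g ex]] := mono_short_exact BCE BQE.
exact: res_le_ext ex.
Qed.

Lemma mono_res_coker d (B BC BQ : upset n) m0 :
  (forall m, BC m = B (m + m0)%MM) -> (forall m, BQ m = B m || (m0 <= m)%MM) ->
  res_le d (quotmod (mono_ideal BC)) -> res_le d.+1 (quotmod (mono_ideal B)) ->
  res_le d.+1 (quotmod (mono_ideal BQ)).
Proof.
move=> BCE BQE; have [f [g ex]] := mono_short_exact BCE BQE.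
exact: res_le_coker ex.
Qed.

(** The ideal is zero, so the projection from the free module [S] has trivial kernel. *)
Lemma mono_res_pred0 (B : upset n) :
  (forall m, B m = false) -> res_le 1 (quotmod (mono_ideal B)).
Proof.
move=> B0.
have lin_pi : linear (fun p : S => \pi_(quotmod (mono_ideal B)) p).
  by move=> a p q; rewrite quotmod_piD quotmod_piZ.
apply: (res_le_cover (P := S) (p := linear_of lin_pi)).
- exact: projective_regular.
- by move=> u; exists (repr u); rewrite /= reprK.
move=> /= [p p_ker]; apply: val_inj => /=; move: p_ker; rewrite unfold_in /ker_pred.
rewrite -(linear0 (linear_of lin_pi)) /= quotmod_pi_eq subr0 => /mono_idealP Bp.
apply/eqP; rewrite -msupp_eq0; case: (msupp _) Bp => // m s /(_ m).
by rewrite B0 mem_head => /(_ isT).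
Qed.

End MonomialIdeals.

(* Locked to keep [inE] from unfolding it. *)
HB.lock Definition mnm_supp (T : finType) (m : 'X_{1..#|T|}) : {set T} :=
  [set x | m (enum_rank x) != 0%N].

(** * Ideals generated by variables and edges *)

Section EdgeIdeals.
Variables (T : finType) (e : rel T) (k : fieldType).
Hypotheses (e_sym : symmetric e) (e_irr : irreflexive e).
Implicit Types (A W : {set T}) (x y : T) (m : 'X_{1..#|T|}).

Lemma in_mnm_supp x m : (x \in mnm_supp m) = (m (enum_rank x) != 0%N).
Proof. by rewrite mnm_supp.unlock inE. Qed.

Lemma mnm_suppD m m' : mnm_supp (m + m')%MM = mnm_supp m :|: mnm_supp m'.
Proof. by apply/setP => x; rewrite !(inE, in_mnm_supp) mnmDE addn_eq0 negb_and. Qed.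

Lemma mnm_supp1 x : mnm_supp U_(enum_rank x) = [set x].
Proof.
apply/setP => y; rewrite !(inE, in_mnm_supp) mnm1E (inj_eq enum_rank_inj).
by rewrite [y == x]eq_sym; case: (x == y).
Qed.

(* The monomials of the ideal generated by the variables in A and the edges of
   the subgraph induced on W. *)
Definition edge_pred A W m : bool :=
  [exists x in mnm_supp m,
    (x \in A) || [exists y in mnm_supp m, [&& x \in W, y \in W & e x y]]].

Lemma edge_predP A W m :
  reflect ((exists2 x, x \in mnm_supp m & x \in A) \/
           exists x y, [/\ x \in mnm_supp m, y \in mnm_supp m, x \in W, y \in W & e x y])
          (edge_pred A W m).
Proof.
apply: (iffP exists_inP) => [[x mx /orP[Ax|]]|[[x mx Ax]|[x [y [mx my Wx Wy exy]]]]].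
- by left; exists x.
- by move=> /exists_inP[y my /and3P[Wx Wy exy]]; right; exists x, y.
- by exists x; rewrite ?Ax.
- by exists x => //; apply/orP; right; apply/exists_inP; exists y => //; apply/and3P.
Qed.

Fact edge_predD A W m m' : edge_pred A W m -> edge_pred A W (m + m')%MM.
Proof.
move=> /edge_predP H; apply/edge_predP; rewrite mnm_suppD.
case: H => [[x mx Ax]|[x [y [mx my Wx Wy exy]]]].
  by left; exists x; rewrite // inE mx.
by right; exists x, y; split; rewrite // inE ?mx ?my.
Qed.

Definition edge_upset A W := Upset (@edge_predD A W).

Definition edge_mod A W : lmodType {mpoly k[#|T|]} :=
  quotmod (mono_ideal k (edge_upset A W)).

Definition nbhd W x : {set T} := [set y in W | e x y].

(** Multiplying by [x] supplies one end of every edge at [x], so the neighbours of [x] become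
    variables. Edges at these neighbours are then redundant, and [x] itself is free. *)
Lemma edge_pred_colon A W x m : x \in W -> x \notin A ->
  edge_pred (A :|: nbhd W x) (W :\: (x |: nbhd W x)) m
  = edge_pred A W (m + U_(enum_rank x))%MM.
Proof.
move=> Wx Ax; apply/edge_predP/edge_predP; rewrite mnm_suppD mnm_supp1.
  case=> [[y my]|[y [z [my mz]]]].
    rewrite !inE => /orP[Ay|/andP[Wy exy]]; first by left; exists y; rewrite // inE my.
    by right; exists x, y; rewrite !inE eqxx my orbT.
  rewrite !inE => /andP[_ Wy] /andP[_ Wz] eyz.
  by right; exists y, z; rewrite !inE my mz.
case=> [[y]|[y [z []]]].
  rewrite !inE => /orP[my|/eqP->] Ay; last by rewrite Ay in Ax.
  by left; exists y; rewrite // inE ?Ay // inE.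
rewrite !inE => my mz Wy Wz eyz.
case: (boolP (e x y)) my => [exy|nexy].
  case: eqP exy => [->|_ exy]; first by rewrite e_irr.
  rewrite orbF => my; left; exists y => //.
  by rewrite !inE Wy exy orbT.
case: (boolP (e x z)) mz => [exz|nexz].
  case: eqP exz => [->|_ exz]; first by rewrite e_irr.
  rewrite orbF => mz _; left; exists z => //.
  by rewrite !inE Wz exz orbT.
(* Neither end is adjacent to [x], so neither equals [x], and the edge survives the deletion. *)
have nyx : (y == x) = false by apply: contraNF nexz => /eqP <-.
have nzx : (z == x) = false by apply: contraNF nexy => /eqP <-; rewrite e_sym.
rewrite nyx nzx !orbF => mz my; right; exists y, z.
by rewrite !inE nyx nzx Wy Wz (negbTE nexy) (negbTE nexz).
Qed.

(** Once [x] is a variable of the ideal, the edges at [x] are redundant. *)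
Lemma edge_pred_quot A W x m :
  edge_pred (x |: A) (W :\ x) m = edge_pred A W m || (U_(enum_rank x) <= m)%MM.
Proof.
rewrite lep1mP -in_mnm_supp; apply/edge_predP/orP.
  case=> [[y my]|[y [z [my mz]]]].
    rewrite !inE => /orP[/eqP<-|Ay]; first by right.
    by left; apply/edge_predP; left; exists y.
  rewrite !inE => /andP[_ Wy] /andP[_ Wz] eyz.
  by left; apply/edge_predP; right; exists y, z.
case=> [/edge_predP|mx]; last by left; exists x; rewrite // !inE eqxx.
case=> [[y my Ay]|[y [z [my mz Wy Wz eyz]]]].
  by left; exists y; rewrite // inE Ay orbT.
case: (eqVneq y x) => [yx|nyx]; first by left; exists y; rewrite // !inE yx eqxx.
case: (eqVneq z x) => [zx|nzx]; first by left; exists z; rewrite // !inE zx eqxx.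
by right; exists y, z; rewrite !inE nyx nzx.
Qed.

Lemma edge_mod_ext A W x d : x \in W -> x \notin A ->
  res_le d (edge_mod (A :|: nbhd W x) (W :\: (x |: nbhd W x))) ->
  res_le d (edge_mod (x |: A) (W :\ x)) -> res_le d (edge_mod A W).
Proof.
move=> Wx Ax; apply: (mono_res_ext (m0 := U_(enum_rank x))) => m.
  exact: edge_pred_colon.
exact: edge_pred_quot.
Qed.

(** Each variable is a nonzerodivisor modulo the others, so the colon ideal is unchanged and
    [mono_res_coker] raises the bound by one per variable. *)
Lemma edge_mod_vars A : res_le #|A|.+1 (edge_mod A set0).
Proof.
move: {-1}#|A| (erefl #|A|) => r; elim: r A => [|r IHr] A cardA.
  apply: mono_res_pred0 => m; rewrite (cards0_eq cardA).
  by apply/edge_predP => -[[x]|[x [y []]]]; rewrite inE.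
have [x Ax] : exists x, x \in A by apply/card_gt0P; rewrite cardA.
have cardAx : #|A :\ x| = r by apply/eqP; rewrite -eqSS -cardA (cardsD1 x A) Ax.
apply: (mono_res_coker (B := edge_upset (A :\ x) set0) (BC := edge_upset (A :\ x) set0)
    (m0 := U_(enum_rank x))).
- move=> m /=; apply/edge_predP/edge_predP; rewrite mnm_suppD mnm_supp1.
    case=> [[y my Ay]|[y [z [_ _]]]]; last by rewrite inE.
    by left; exists y; rewrite // inE my.
  case=> [[y]|[y [z [_ _]]]]; last by rewrite inE.
  rewrite !inE => + /andP[/negbTE nyx Ay]; rewrite nyx orbF => my.
  by left; exists y; rewrite // !inE nyx.
- by move=> m; rewrite /= -edge_pred_quot setD1K // set0D.
- exact: IHr.
- exact/res_leS/IHr.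
Qed.

(** A monomial whose support contains an edge is a multiple of that generator, so the monomial
    description agrees with the generated ideal. *)
Lemma edge_quotient_res d : res_le d.+1 (edge_mod set0 setT) ->
  res_le d.+1 (edge_quotient e k).
Proof.
have [|f [f_inj f_surj]] := @quotmod_iso _ _ (mono_ideal k (edge_upset set0 setT))
    (edge_ideal e k); last exact: (res_le_iso f_inj f_surj).
have edge_idealE q : (q \in edge_ideal e k) = `[< gen_ideal_prop (@edge_gens T e k) q >].
  by [].
move=> p; apply/mono_idealP/idP => [Bp|]; last first.
  rewrite edge_idealE => /asboolP[s sE ->]; apply/mono_idealP.
  rewrite big_seq; apply: rpred_sum => cg /sE[x [y [exy ->]]].
  apply: (rpredZ cg.1); apply/mono_idealP => m.
  rewrite /vertex_var -mpolyXD msuppX inE => /eqP->; apply/edge_predP; right.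
  by exists x, y; rewrite mnm_suppD !mnm_supp1 !inE !eqxx orbT.
rewrite [p]mpolyE big_seq; apply: rpred_sum => m /Bp /edge_predP.
  case=> [[x _]|[x [y [mx my _ _ exy]]]]; first by rewrite inE.
  rewrite edge_idealE; apply/asboolP.
  pose mxy := (U_(enum_rank x) + U_(enum_rank y))%MM.
  exists [:: ((p : {mpoly k[#|T|]})@_m *: 'X_[m - mxy],
              vertex_var k x * vertex_var k y)].
    by move=> cg; rewrite inE => /eqP-> /=; exists x, y.
  rewrite big_seq1 /= /vertex_var -scalerAl -!mpolyXD submK //.
  apply/mnm_lepP => i; rewrite mnmDE !mnm1E.
  (* Since the ends differ, [mxy] has exponents at most 1 and divides any monomial containing
     both. *)
  have nxy : enum_rank x != enum_rank y.
    by rewrite (inj_eq enum_rank_inj); apply: contraTneq exy => ->; rewrite e_irr.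
  rewrite !in_mnm_supp in mx my.
  case: (eqVneq (enum_rank x) i) => [<-|_].
    by rewrite eq_sym (negbTE nxy) addn0 lt0n.
  by case: (eqVneq (enum_rank y) i) => [<-|_]; rewrite ?add0n ?lt0n.
Qed.

End EdgeIdeals.

(** No edge inside [W] meets [v], so both ideals have the same monomials. *)
Lemma edge_mod_isolated (T : finType) (e : rel T) (k : fieldType) (A W : {set T}) v d :
  symmetric e -> v \in W -> nbhd e W v = set0 ->
  res_le d.+1 (edge_mod e k A (W :\ v)) -> res_le d.+1 (edge_mod e k A W).
Proof.
move=> e_sym Wv /setP Nv0.
have [|f [f_inj f_surj]] := @quotmod_iso _ _ (mono_ideal k (edge_upset e A (W :\ v)))
    (mono_ideal k (edge_upset e A W)); last exact: (res_le_iso f_inj f_surj).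
move=> p; apply: eq_all => m /=; apply/edge_predP/edge_predP.
  case=> [|[x [y []]]]; first by left.
  by rewrite !inE => mx my /andP[_ Wx] /andP[_ Wy] exy; right; exists x, y.
case=> [|[x [y [mx my Wx Wy exy]]]]; first by left.
right; exists x, y; split=> //; rewrite !inE ?Wx ?Wy andbT.
  by apply/eqP => xv; have := Nv0 y; rewrite !inE Wy -xv exy.
by apply/eqP => yv; have := Nv0 x; rewrite !inE Wx -yv e_sym exy.
Qed.

(** * Claw-free graphs and the branching at a vertex *)

Section ClawFree.
Variables (T : finType) (e : rel T).
Hypotheses (e_sym : symmetric e) (e_irr : irreflexive e) (e_claw : claw_free e).

(** Otherwise [x], [y], [z] would be the leaves of an induced claw centred at [v]. *)
Lemma claw_free_adj v x y z : e v x -> e v y -> e v z -> uniq [:: x; y; z] ->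
  [|| e x y, e x z | e y z].
Proof.
move=> vx vy vz uxyz; apply: contraT; rewrite !negb_or => /and3P[nxy nxz nyz].
case: e_claw; pose t := [tuple x; y; z].
have vt i : e v (tnth t i) by case: i => -[|[|[|]]] //= i; rewrite (tnth_nth v).
exists (fun u : 'I_1 + 'I_3 => match u with inl _ => v | inr i => tnth t i end).
  have vnt i : v <> tnth t i by move=> vE; have := vt i; rewrite -vE e_irr.
  move=> [i|i] [j|j] //=; first by rewrite !ord1.
  - by move=> /vnt.
  - by move=> /esym/vnt.
  - by have /tuple_uniqP tinj : uniq t by []; move=> /tinj ->.
case=> i [] j /=; [exact: e_irr | exact: vt | by rewrite e_sym; exact: vt | ].
case: i j => -[|[|[|]]] //= ? [[|[|[|]]] //= ?]; rewrite !(tnth_nth v) /= ?e_irr //;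
  by apply/negbTE; rewrite // e_sym.
Qed.

(* The complement of a claw-free neighbourhood is triangle-free, so two of its
   adjacent vertices have disjoint neighbourhoods. *)
Lemma claw_free_sparse v (R : {set T}) : R \subset e v -> R != set0 ->
  exists2 x, x \in R & (#|[set y in R | (y != x) && ~~ e x y]| <= #|R|./2)%N.
Proof.
move=> /subsetP vR /set0Pn[x Rx].
pose co x := [set y in R | (y != x) && ~~ e x y].
have [co0|/set0Pn[y]] := eqVneq (co x) set0.
  by exists x; rewrite // -/(co x) co0 cards0.
rewrite inE => /and3P[Ry nyx nexy].
have disj : co x :&: co y = set0.
  apply/setP => z; rewrite !inE; apply/negbTE/negP.
  move=> /andP[/and3P[Rz nzx nexz] /and3P[_ nzy neyz]].
  have := claw_free_adj (vR _ Rx) (vR _ Ry) (vR _ Rz).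
  rewrite (negbTE nexy) (negbTE nexz) (negbTE neyz) /= !inE !negb_or.
  by rewrite eq_sym nyx eq_sym nzx eq_sym nzy => /(_ isT).
have /subset_leq_card : co x :|: co y \subset R.
  by apply/subsetP => z; rewrite !inE => /orP[] /andP[].
rewrite cardsU disj cards0 subn0 => le_R.
(* Of two disjoint subsets of [R], the smaller has at most half of its elements. *)
case: (leqP #|co x| #|co y|) => le_xy; [exists x | exists y] => //; rewrite -/(co _); lia.
Qed.

Variables (k : fieldType) (c : nat).
Hypothesis c_ge : forall x y, e x y -> (deg e x + (deg e y)./2 <= c)%N.

(* Removing x and D costs |D| variables; for |D| <= c this does not exceed the
   budget c / (c + 1) per removed vertex. *)
Lemma edge_mod_bound (A W : {set T}) d :
  (c.+1 * #|A| + c * #|W| < c.+1 * d.+1)%N -> [disjoint A & W] ->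
  res_le d.+1 (edge_mod e k A W).
Proof.
have [w] := ubnP #|W|; elim: w A W => // w IHw A W ltW bound disjAW.
have [W0|/set0Pn[v Wv]] := eqVneq W set0.
  rewrite W0 cards0 muln0 addn0 ltn_pmul2l // in bound.
  by rewrite W0; apply: res_le_leq bound _; apply: edge_mod_vars.
(* The induction hypothesis in the form that closes every leaf of the branching. *)
have remove x (D : {set T}) : x \in W -> x \notin D -> D \subset W -> (#|D| <= c)%N ->
    res_le d.+1 (edge_mod e k (A :|: D) (W :\: (x |: D))).
  move=> Wx Dx DW leD.
  have cardW : (#|W| = #|D|.+1 + #|W :\: (x |: D)|)%N.
    have xDW : x |: D \subset W by rewrite subUset sub1set Wx.
    by rewrite -(cardsID (x |: D) W) (setIidPr xDW) cardsU1 Dx.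
  have cardA : (#|A :|: D| <= #|A| + #|D|)%N by rewrite cardsU leq_subr.
  apply: IHw; first lia.
    apply: leq_ltn_trans bound; rewrite cardW.
    apply: (@leq_trans (c.+1 * (#|A| + #|D|) + c * #|W :\: (x |: D)|)); last by nia.
    by rewrite leq_add2r leq_mul2l cardA orbT.
  move: disjAW; rewrite -!setI_eq0 => /eqP AW0; apply/eqP/setP => y.
  move/setP/(_ y): AW0; rewrite !inE.
  by case: (y \in A); case: (y \in D); case: (y == x) => //= ->.
pose N := nbhd e W v; have nNv : v \notin N by rewrite !inE e_irr andbF.
have NW : N \subset W by apply/subsetP => y; rewrite inE => /andP[].
have cardN : (#|N| <= deg e v)%N.
  by apply/subset_leq_card/subsetP => y; rewrite !inE => /andP[].
pose res R := res_le d.+1 (edge_mod e k (A :|: R) (W :\: R)).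
have resN : res N.
  have leN : (#|N| <= c)%N.
    have [->|/set0Pn[y]] := eqVneq N set0; first by rewrite cards0.
    by rewrite inE => /andP[_ /c_ge]; lia.
  apply: (edge_mod_isolated (v := v)) => //; first by rewrite inE nNv.
    by apply/setP => y; rewrite !inE; case: (y \in W); case: (e v y).
  by rewrite setDDl [N :|: _]setUC; apply: remove.
(* The ordering is run backwards from [N] to the empty set: the vertex taken out of [R] is the one
   treated last. *)
suff res0 r (R : {set T}) : #|R| = r -> R \subset N -> res R -> res set0.
  by have := res0 _ _ erefl (subxx N) resN; rewrite /res setU0 setD0.
elim: r R => [|r IHr] R cardR RN; first by rewrite (cards0_eq cardR).
have Rv : R \subset e v.
  by apply/subsetP => y /(subsetP RN); rewrite inE => /andP[].
have [|x Rx sparse] := claw_free_sparse Rv; first by rewrite -card_gt0 cardR.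
move=> resR; apply: (IHr (R :\ x)).
- by move: cardR; rewrite (cardsD1 x R) Rx => -[].
- exact: subset_trans (subD1set R x) RN.
have Nx := subsetP RN x Rx; rewrite inE in Nx; have [Wx evx] := andP Nx.
(* [D] collects the variables of the colon branch: the earlier neighbours of [v] and the remaining
   neighbours of [x]. *)
pose W' := W :\: (R :\ x); pose D := (R :\ x) :|: nbhd e W' x.
have nDx : x \notin D by rewrite !inE eqxx e_irr andbF.
have leD : (#|D| <= c)%N.
  (* Members of [R] adjacent to [x] are already counted in [deg e x]; the others number at most
     [(deg e v)./2], so [c_ge] for the ordered pair [x], [v] applies. *)
  have DE : D \subset [set y in R | (y != x) && ~~ e x y] :|: [set y | e x y].
    apply/subsetP => y; rewrite !inE.
    by case: (e x y); rewrite ?orbT ?andbT ?andbF ?orbF // andbC.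
  have leR : (#|R| <= deg e v)%N := leq_trans (subset_leq_card RN) cardN.
  have := subset_leq_card DE; have := c_ge (etrans (e_sym _ _) evx).
  by rewrite cardsU /deg in leR *; lia.
have DW : D \subset W.
  apply/subsetP => y; rewrite !inE => /orP[/andP[_ /(subsetP RN)]|/andP[/andP[_ ->]] //].
  by rewrite inE => /andP[].
have xW' : x \in W' by rewrite !inE eqxx Wx.
have xA' : x \notin A :|: R :\ x.
  by rewrite !inE eqxx orbF; apply: contraL Wx => Ax; rewrite (disjointFr disjAW Ax).
apply: (edge_mod_ext e_sym e_irr xW' xA').
  have -> : W' :\: (x |: nbhd e W' x) = W :\: (x |: D) by rewrite setDDl setUCA.
  by rewrite -setUA -/D; apply: remove.
have -> : x |: (A :|: R :\ x) = A :|: R by rewrite setUCA setD1K.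
have -> : W' :\ x = W :\: R by rewrite setDDl setUC setD1K.
exact: resR.
Qed.

End ClawFree.

(** * The bound over the rationals *)

Theorem theorem5p5 (k : fieldType) (n : nat) (T : finType) (e : rel T)
    (e_sym : symmetric e) (e_irr : irreflexive e) (cardT : #|T| = n)
    (has_edge : exists x y : T, e x y) (e_claw : claw_free e) :
  exists2 d : nat, has_pd (edge_quotient e k) d
    & d%:R <= n%:R * (1 - 1 / (degC e)%:R) :> rat.
Proof.
have degC_ge x y : e x y -> (deg e x + (deg e y)./2 + 1 <= degC e)%N.
  move=> exy; pose F (p : T * T) := (deg e p.1 + (deg e p.2)./2 + 1)%N.
  exact: (leq_bigmax_cond (x, y) (F := F)).
(* An edge makes [degC e] positive; from here on it is [c.+1]. *)
case: (degC e) degC_ge => [|c] degC_ge.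
  by have [x [y /degC_ge]] := has_edge; rewrite addn1.
have c_ge x y : e x y -> (deg e x + (deg e y)./2 <= c)%N.
  by move/degC_ge; rewrite addn1.
(* Initially there are no variables and [n] vertices, so the budget is [c * n]; its integer quotient
   by [c.+1] bounds the projective dimension. *)
have /(edge_quotient_res e_irr)/res_le_pd_le/ex_has_pd[d pd_d le_d] :
    res_le ((c * n) %/ c.+1).+1 (edge_mod e k set0 setT).
  apply: (edge_mod_bound e_sym e_irr e_claw k c_ge).
  2: by rewrite disjoints_subset sub0set.
  rewrite cards0 muln0 cardsT cardT add0n [ltnRHS]mulnC; exact: ltn_ceil.
exists d => //.
have -> : 1 - 1 / c.+1%:R = c%:R / c.+1%:R :> rat.
  by rewrite -[X in X - _](@divff _ c.+1%:R) ?pnatr_eq0 // -mulrBl -natr1 addrK.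
rewrite mulrA ler_pdivlMr ?ltr0n // -!natrM ler_nat mulnC.
rewrite [(n * c)%N]mulnC (leq_trans _ (leq_trunc_div _ c.+1)) //.
by rewrite mulnC leq_mul2r le_d orbT.
Qed.
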